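(* Let $\mathcal{C}$ be a Cantor set endowed with the structure of a topological group, with Haar measure $\mu_{\mathcal{C}}$, and let $\lambda$ be Lebesgue measure on $[0,1]$. Then there is a continuous mapping $\widehat{\phi}\colon\mathcal{C}\to[0,1]$ satisfying $\widehat{\phi}(\mu_{\mathcal{C}})=\lambda$, where $\widehat{\phi}(\mu_{\mathcal{C}})$ is the image measure $A\mapsto\mu_{\mathcal{C}}(\widehat{\phi}^{-1}(A))$ on Borel sets $A\subseteq[0,1]$.
   Context: A Cantor set is a nonempty compact Hausdorff zero-dimensional space that has a countable base for its topology and in which every point is a limit point. A topological group structure is compatible with the given topology (multiplication and inversion are continuous). Haar measure on a compact group is the unique left translation invariant Borel measure normalized to be a probability measure. *)

(* Defs.v *)
From HB Require Import structures.
From mathcomp Require Import all_boot all_order all_algebra.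
From mathcomp Require Import all_classical all_reals all_analysis.

Set Implicit Arguments.
Unset Strict Implicit.
Unset Printing Implicit Defensive.

Local Open Scope classical_set_scope.
Local Open Scope ring_scope.

HB.mixin Record isTopologicalGroup G
    & PointedTopological G & Group G := {
  mulg_continuous : continuous (fun x : G * G => (x.1 * x.2)%g) ;
  invg_continuous : continuous (fun x : G => (x^-1)%g)
}.

(* The group law need not be commutative. The distinguished point is arbitrary
   (it need not be 1) and carries no content: it is there because a measurable
   type is required to be pointed. *)
#[short(type="topologicalGroupType")]
HB.structure Definition TopologicalGroup :=
  {G of PointedTopological G & Group G & isTopologicalGroup G}.

(* [cantor_like] says that the space is compact, Hausdorff, zero-dimensional
   and without isolated points; it assumes no countable base. *)
Definition cantor_set (T : topologicalType) :=
  [/\ [set: T] !=set0, cantor_like T & @second_countable T].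

(* [zero_dimensional] asks that distinct points be separated by a clopen set;
   for compact Hausdorff spaces this is the existence of a base of clopens. *)
Lemma zero_dimensional_clopen_basis (T : topologicalType) :
  compact [set: T] -> hausdorff_space T ->
  zero_dimensional T <-> exists2 B : set_system T, basis B & B `<=` clopen.
Proof.
move=> cT hT; split=> [zT|[B [_ nB] Bclopen] x y xy].
  exists clopen => //; split=> [U []//|x U Ux].
  have [V [Vx cV] VU] := zero_dimensional_cvg hT zT cT Ux.
  by exists V => //; split; have [] := cV.
have [U [Ux Uy]] : exists A, nbhs x A /\ ~ A y.
  apply: contrapT => noA; move/eqP: xy; apply; apply: hT => A C Ax Cy.
  exists y; split; last exact: nbhs_singleton.
  by apply: contrapT => Ay; apply: noA; exists A.
have [V [BV Vx] VU] := nB x U Ux.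
by exists V; split => //; [exact: Bclopen|move=> /VU].
Qed.

Definition borelType (T : ptopologicalType) :=
  g_sigma_algebraType (@open T).

Definition left_invariant (R : realType) (G : topologicalGroupType)
    (mu : set G -> \bar R) :=
  forall (g : G) (A : set G), @measurable _ (borelType G) A ->
    mu [set (g * x)%g | x in A] = mu A.

(* Total mass 1 is part of the type of [mu]. *)
Definition haar_probability (R : realType) (G : topologicalGroupType)
    (mu : probability (borelType G) R) :=
  left_invariant mu.

(* Main.v *)
Require Import Defs.
From HB Require Import structures.
From mathcomp Require Import all_boot all_order all_algebra.
From mathcomp Require Import all_classical all_reals all_analysis.
From mathcomp Require Import measurable_realfun ring lra.

(* A nonatomic probability measure on R has a continuous cumulative distribution
   function F, and F transports it to the uniform law. Haar measure on an
   infinite group is nonatomic, because all points have the same mass. The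
   Cantor set C embeds in R by the base 3 expansion whose n-th digit, 0 or 1, is
   given by membership in the n-th clopen set; phi is the composition of F with
   this embedding. Base 3 makes the expansion injective. *)

Set Implicit Arguments.
Unset Strict Implicit.
Unset Printing Implicit Defensive.

Import Order.TTheory GRing.Theory Num.Theory.
Import numFieldNormedType.Exports.

Local Open Scope classical_set_scope.
Local Open Scope ring_scope.

(** * Base 3 expansions with digits 0 and 1 *)

Section ternary.
Context {R : realType}.
Implicit Types u v : bool ^nat.

Definition ternary_digit u : R ^nat := fun k => (u k)%:R / 3 ^+ k.

Definition ternary u : R := limn (series (ternary_digit u)).

(** Comparison with the geometric series of ratio 1/3. Without convergence, [limn] would be a mere
    default value. *)
Lemma is_cvg_ternary u : cvgn (series (ternary_digit u)).
Proof.
apply: (@series_le_cvg _ _ (geometric 1 3^-1)) => [n|n|n|].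
- by rewrite /ternary_digit divr_ge0// exprn_ge0.
- by rewrite /geometric/= mul1r exprn_ge0.
- rewrite /geometric/= mul1r exprVn /ternary_digit -[leRHS]mul1r ler_wpM2r//.
  by case: (u n).
- by apply: is_cvg_geometric_series; rewrite ger0_norm ?invr_ge0//; lra.
Qed.

Lemma ternary_digit_dist u v n :
  `|ternary_digit u n - ternary_digit v n| <= 3 ^- n.
Proof.
rewrite /ternary_digit -mulrBl normrM [X in _ * X]ger0_norm; last first.
  by rewrite invr_ge0 exprn_ge0.
rewrite -[leRHS]mul1r ler_wpM2r ?invr_ge0 ?exprn_ge0//.
by case: (u n) (v n) => [] [];
  rewrite ?subrr ?normr0// ?subr0 ?sub0r ?normrN normr1.
Qed.

(** The digits before [n] cancel and the [n]-th pair is subtracted, so only indices [n + 1] to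
    [n + m] remain; the bound is the sum of [3 ^- k] over them. *)
Lemma series_ternary_dist u v n m : (forall k, (k < n)%N -> u k = v k) ->
  `|series (ternary_digit u) (n.+1 + m)%N
    - series (ternary_digit v) (n.+1 + m)%N
    - (ternary_digit u n - ternary_digit v n)|
  <= (3 ^- n - 3 ^- (n + m)) / 2.
Proof.
move=> uv; elim: m => [|m IH].
  rewrite !addn0 subrr mul0r !seriesEord/= !big_ord_recr/=.
  rewrite (eq_bigr (fun i : 'I_n => ternary_digit v i)) => [|i _]; last first.
    by rewrite /ternary_digit uv.
  by rewrite [X in `|X|](_ : _ = 0) ?normr0//; ring.
rewrite addnS (seriesSr (ternary_digit u) (n.+1 + m)).
rewrite (seriesSr (ternary_digit v) (n.+1 + m)).
set d := (n.+1 + m)%N in IH *.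
rewrite (_ : _ - _ = (series (ternary_digit u) d
    - series (ternary_digit v) d - (ternary_digit u n - ternary_digit v n))
    + (ternary_digit u d - ternary_digit v d)); last by ring.
apply: (le_trans (ler_normD _ _)).
apply: (le_trans (lerD IH (ternary_digit_dist u v d))).
rewrite /d addSn addnS !exprSr !invfM; lra.
Qed.

Lemma ternary_dist u v n : (forall k, (k < n)%N -> u k = v k) ->
  `|ternary u - ternary v - (ternary_digit u n - ternary_digit v n)|
  <= 3 ^- n / 2.
Proof.
move=> uv; set d := ternary_digit u n - ternary_digit v n.
have c : (series (ternary_digit u) - series (ternary_digit v)) N - d
    @[N --> \oo] --> ternary u - ternary v - d.
  by apply: cvgB; [apply: cvgB; exact: is_cvg_ternary|exact: cvg_cst].
apply: (cvgr_to_le (cvg_norm c)).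
near=> N.
have -> : N = (n.+1 + (N - n.+1))%N.
  by rewrite subnKC//; near: N; exact: nbhs_infty_ge.
apply: (le_trans (series_ternary_dist (N - n.+1) uv)).
by rewrite ler_wpM2r// ?invr_ge0// gerBl invr_ge0 exprn_ge0.
Unshelve. all: by end_near. Qed.

(** At the first index [n] where the digits differ, they contribute [3 ^- n] to the distance, and
    all later digits together can offset only half of it. *)
Lemma ternary_inj : injective ternary.
Proof.
move=> u v uv; apply/funext => n; elim/ltn_ind: n => n IH.
apply/eqP/negPn/negP => unv.
have := ternary_dist IH.
rewrite uv subrr sub0r normrN /ternary_digit -mulrBl normrM.
have -> : `|(u n)%:R - (v n)%:R| = 1 :> R.
  by case: (u n) (v n) unv => [] []//= _; rewrite ?subr0 ?sub0r ?normrN normr1.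
have p : 0 < 3 ^- n :> R by rewrite invr_gt0 exprn_gt0.
by rewrite mul1r (ger0_norm (ltW p)) => ?; lra.
Qed.

Lemma ternary_close u v n : (forall k, (k < n)%N -> u k = v k) ->
  `|ternary u - ternary v| <= 3 ^- n * 2.
Proof.
move=> uv; have := ternary_dist uv.
have := ternary_digit_dist u v n.
have p : 0 < 3 ^- n :> R by rewrite invr_gt0 exprn_gt0.
rewrite !ler_norml; lra.
Qed.

(** Membership in a clopen set is locally constant, so finitely many leading digits are constant
    near [x]; by [ternary_close] the other digits matter little. *)
Lemma ternary_continuous (T : topologicalType) (A : (set T)^nat) :
  (forall n, clopen (A n)) ->
  continuous (fun x => ternary (fun n => x \in A n)).
Proof.
move=> cA x; apply/cvgrPdist_le => e e0.
have [n ne] : exists n, 3 ^- n * 2 <= e.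
  have : geometric 2 3^-1 n @[n --> \oo] --> (0 : R).
    by apply: cvg_geometric; rewrite ger0_norm ?invr_ge0//; lra.
  move/cvgrPdist_le => /(_ _ e0)[n _ /(_ n (leqnn n))].
  rewrite /= sub0r normrN ger0_norm; last by rewrite mulr_ge0// exprn_ge0.
  by rewrite exprVn mulrC; exists n.
have near_eq k : \forall y \near x, (x \in A k) = (y \in A k).
  have [oA clA] := cA k.
  have [xA|xA] := pselect (A k x).
    have : nbhs x (A k) by exact: open_nbhs_nbhs.
    by apply: filterS => y yA; rewrite !mem_set.
  have : nbhs x (~` A k).
    by apply: open_nbhs_nbhs; split => //; exact: closed_openC.
  by apply: filterS => y yA; rewrite !memNset.
have : \forall y \near x, forall k, (k < n)%N -> (x \in A k) = (y \in A k).
  elim: {ne} n => [|n IH]; first by apply: nearW.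
  apply: filterS (filterI IH (near_eq n)) => y [yk yn] k.
  by rewrite ltnS leq_eqVlt => /predU1P[->//|]; exact: yk.
by apply: filterS => y xy; exact: le_trans (ternary_close xy) ne.
Qed.

End ternary.

(** * Borel sets and the embedding of a Cantor set in the line *)

Section borel_cantor.
Context {R : realType} {T : ptopologicalType}.

Lemma continuous_borel_measurable (f : T -> R) : continuous f ->
  measurable_fun [set: borelType T] (f : borelType T -> R).
Proof.
move=> cf; apply: (measurability _ (RGenOpens.measurableE R)).
move=> _ [_ [a [b ->]] <-]; rewrite setTI; apply: sub_sigma_algebra.
by move/continuousP : cf; apply; exact: interval_open.
Qed.

Lemma closed_borel_measurable (A : set T) : closed A ->
  measurable (A : set (borelType T)).
Proof.
move=> cA; rewrite -(setCK A); apply: measurableC.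
by apply: sub_sigma_algebra; exact: closed_openC.
Qed.

(** In a finite accessible space the complement of a point is closed, so the point would be
    isolated. *)
Lemma perfect_infinite : accessible_space T -> perfect_set [set: T] ->
  infinite_set [set: T].
Proof.
move=> aT /perfectTP pT fT; apply: (pT point).
rewrite -(setCK [set point]); apply: closed_openC.
move/accessible_finite_set_closed : aT; apply.
exact: sub_finite_set fT.
Qed.

Lemma cantor_embedding : cantor_set T ->
  exists2 h : T -> R, continuous h & injective h.
Proof.
move=> [_ [_ kT hT zT] scT].
(* Compactness and the countable base leave only countably many clopen sets; [A] enumerates them
   all, and zero-dimensionality makes them separate points. *)
have /pfcard_geP[noclopen|[A]] := clopen_countable kT scT.
  by have := @clopen0 T; rewrite noclopen.
have cA n : clopen (A n) by exact: funS.
exists (fun x => ternary (fun n => x \in A n)).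
  exact: ternary_continuous.
move=> x y /ternary_inj xy; apply/eqP/negPn/negP => /zT[U [cU Ux Uy]].
have [n _ AnU] := @surj _ _ _ _ A U cU.
have := congr1 (fun f => f n) xy.
by rewrite AnU mem_set// memNset.
Qed.

End borel_cantor.

(** Left translation by [y * x^-1] carries [x] to [y], so all points have the same mass. An infinite
    space contains [n] distinct points for every [n], so [n] times this mass is at most 1. *)
Lemma haar_atomless (R : realType) (G : topologicalGroupType)
    (mu : probability (borelType G) R) :
  hausdorff_space G -> perfect_set [set: G] -> haar_probability mu ->
  forall x : G, mu [set x] = 0%E.
Proof.
move=> hG pG haar x.
have aG := hausdorff_accessible hG.
have m1 y : @measurable _ (borelType G) [set y].
  by apply: closed_borel_measurable; exact: accessible_closed_set1.
have mu1 y : mu [set y] = mu [set x].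
  rewrite -(haar (y * x^-1)%g [set x])// image_set1.
  by rewrite -mulgA mulVg mulg1.
have mux_fin : mu [set x] \is a fin_num by exact: fin_num_measure.
have mux n : fine (mu [set x]) *+ n <= 1.
  have /infiniteP/pcard_leP[f] := perfect_infinite aG pG.
  rewrite -lee_fin EFin_natmul fineK//.
  have <- : mu (\big[setU/set0]_(i < n) [set f i]) = (mu [set x] *+ n)%E.
    rewrite measure_bigsetU_ord.
    - rewrite (eq_bigr (fun=> mu [set x])) => [|i _]; last exact: mu1.
      by rewrite sumr_const card_ord.
    - by move=> i; exact: m1.
    - apply/trivIsetP => i j _ _ /eqP ij; rewrite -subset0 => _ [/= -> fij].
      by apply/ij/val_inj/(inj _ _ fij); rewrite inE.
  by apply: probability_le1; apply: bigsetU_measurable => i _; exact: m1.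
rewrite -(fineK mux_fin); congr EFin; apply/eqP; rewrite eq_le fine_ge0// andbT.
rewrite leNgt; apply/negP => mux_gt0.
have := mux (Num.truncn (fine (mu [set x]))^-1).+1.
apply/negP; rewrite -ltNge -mulr_natr mulrC -ltr_pdivrMr// div1r.
exact: truncnS_gt.
Qed.

(** * Atomless laws on the line and their distribution functions *)

Section continuous_cdf.
Context d {T : measurableType d} {R : realType} (P : probability T R).
Variable X : {RV P >-> R}.
Hypothesis X_atomless : forall r, P (X @^-1` [set r]) = 0%E.

Let F r := fine (cdf X r).

Let cdfF r : cdf X r = (F r)%:E.
Proof. by rewrite /F fineK// fin_num_measure. Qed.

Let F_nd : {homo F : r s / r <= s}.
Proof. by move=> r s rs; rewrite -lee_fin -!cdfF; exact: cdf_nondecreasing. Qed.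

Lemma cdf_itvNyo r : P (X @^-1` `]-oo, r[) = cdf X r.
Proof.
rewrite /cdf /distribution /pushforward -(@setUitv1 _ _ _ _ true)//.
rewrite preimage_setU measureU//.
- by rewrite -[LHS]adde0; congr (_ + _)%E; exact/esym/X_atomless.
- exact: (measurable_funPTI X).
- by rewrite -preimage_setI -subset0 => x/= [/[swap] ->]; rewrite in_itv/= ltxx.
Qed.

(** Every distribution function is right continuous. Left continuity comes from the absence of
    atoms, through [cdf_itvNyo]. *)
Lemma continuous_fine_cdf : continuous (fine \o cdf X).
Proof.
move=> a; apply/left_right_continuousP; split; last first.
  by apply: fine_cvg; rewrite -[X in _ --> X]cdfF; exact: cdf_right_continuous.
(* Continuity from below: these closed rays increase to the open ray ending at [a]. *)
have F_seq : F (a - n.+1%:R^-1) @[n --> \oo] --> F a.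
  apply: fine_cvg; rewrite -cdfF -cdf_itvNyo.
  pose G n := X @^-1` `]-oo, (a - n.+1%:R^-1)%R].
  have <- : \bigcup_n G n = X @^-1` `]-oo, a[.
    apply/seteqP; split => [x [n _]|x]; rewrite /G/= !in_itv/=.
      by move=> /le_lt_trans; apply; rewrite gtrBl invr_gt0.
    rewrite -subr_gt0 => Xa; have [n n_lt] := ltr_add_invr Xa.
    by exists n => //=; rewrite in_itv/= lerBrDr addrC -lerBrDr -[leLHS]add0r ltW.
  apply: nondecreasing_cvg_mu => [n||n m nm].
  - exact: measurable_itv.
  - by apply: bigcup_measurable => n _; exact: measurable_itv.
  - apply/subsetPset => x; rewrite /G/= !in_itv/= => /le_trans; apply.
    by rewrite lerB// lef_pV2 ?posrE// ler_nat.
(* By monotonicity one good index [n] controls [F] on the whole interval from [a - n.+1%:R^-1] to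
   [a]. *)
apply/cvgrPdist_le => e e0.
have /cvgrPdist_le/(_ _ e0)[n _ /(_ n (leqnn n))/= Fn] := F_seq.
near=> x.
have xa : a - n.+1%:R^-1 <= x.
  by near: x; apply: nbhs_left_ge; rewrite gtrBl invr_gt0.
have ax : x <= a by near: x; exact: nbhs_left_le.
move: Fn (F_nd xa) (F_nd ax); rewrite !ler_norml /= /F; lra.
Unshelve. all: by end_near. Qed.

Lemma cdf_surjective t : 0 < t < 1 -> exists s, cdf X s = t%:E.
Proof.
move=> /andP[t0 t1].
have [a Fa] : exists a, F a < t.
  have : F r @[r --> -oo] --> (0 : R) by exact/fine_cvg/cvg_cdfNy0.
  move=> /cvgr_lt/(_ t t0) [M [_ MF]].
  by exists (M - 1); apply: MF; rewrite gtrBl.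
have [b Fb] : exists b, t < F b.
  have : F r @[r --> +oo] --> (1 : R) by exact/fine_cvg/cvg_cdfy1.
  move=> /cvgr_gt/(_ t t1) [M [_ MF]].
  by exists (M + 1); apply: MF; rewrite ltrDl.
have ab : a <= b.
  by rewrite leNgt; apply/negP => /ltW/F_nd; lra.
have [] := @IVT R F a b t ab.
- exact/continuous_subspaceT/continuous_fine_cdf.
- by rewrite min_l ?max_r ?F_nd// !ltW.
- by move=> s _ Fs; exists s; rewrite cdfF Fs.
Qed.

Let U x := F (X x).

Let measurable_U : measurable_fun [set: T] U.
Proof.
have mF : measurable_fun [set: R] F.
  exact: nondecreasing_measurable.
exact: (measurableT_comp mF (measurable_funPT X)).
Qed.

(** [F] need not be injective, so the event is not rewritten through an inverse but squeezed between
    events [X <= s] of known mass. *)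
Lemma probability_integral_transform_itvNyo t : 0 < t <= 1 ->
  P (U @^-1` `]-oo, t[) = t%:E.
Proof.
move=> /andP[t0 t1].
have Fle s : P (X @^-1` `]-oo, s]) = cdf X s by [].
have mUt : measurable (U @^-1` `]-oo, t[).
  by rewrite -[X in measurable X]setTI; exact: measurable_U.
apply/eqP; rewrite eq_le; apply/andP; split.
  (* The value 1 need not be attained by [F]; there the total mass gives the bound. *)
  have [t_lt1|] := ltP t 1; last first.
    by move=> ?; rewrite (@le_trans _ _ 1%E) ?probability_le1 ?lee_fin.
  have [|s Fs] := @cdf_surjective t; first by rewrite t0.
  rewrite -Fs -Fle le_measure ?inE//; first exact: (measurable_funPTI X).
  move=> x /=; rewrite !in_itv/= => Ut; rewrite leNgt; apply/negP => /ltW/F_nd.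
  by move: Fs; rewrite cdfF => -[->]; rewrite leNgt Ut.
apply/lee_addgt0Pr => e e0.
have [te|te] := leP t e.
  by rewrite -[leLHS]add0e leeD ?lee_fin.
(* If [X x <= s], then [U x <= t - e < t], so the event has mass at least [t - e]. *)
have [|s Fs] := @cdf_surjective (t - e); first lra.
rewrite -leeBlDr// -EFinB -Fs -Fle le_measure ?inE//.
  exact: (measurable_funPTI X).
move=> x /=; rewrite !in_itv/= => /F_nd/le_lt_trans; apply.
by move: Fs; rewrite cdfF => -[->]; rewrite gtrBl.
Qed.

Lemma fine_cdf_ge0 r : 0 <= fine (cdf X r).
Proof. exact: fine_ge0. Qed.

Lemma fine_cdf_le1 r : fine (cdf X r) <= 1.
Proof. by rewrite -lee_fin -cdfF cdf_le1. Qed.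

Lemma probability_integral_transform (A : set (measurableTypeR R)) :
  measurable A ->
  P ((fun x => fine (cdf X (X x))) @^-1` A) = lebesgue_measure (A `&` `[0, 1]).
Proof.
(* Outside [0 < t <= 1] both sides are 0 or both are 1, since [U] takes its values in the unit
   interval. *)
have rays t : P (U @^-1` `]-oo, t[) =
    lebesgue_measure (`]-oo, t[ `&` `[0, 1] : set (measurableTypeR R)).
  have [t0|t0] := leP t 0.
    rewrite [X in P X](_ : _ = set0); last first.
      rewrite -subset0 => x /=; rewrite in_itv/= ltNge => /negP; apply.
      exact: (le_trans t0 (fine_cdf_ge0 _)).
    rewrite [X in lebesgue_measure X](_ : _ = set0) ?measure0//.
    by rewrite -subset0 => x [/=]; rewrite !in_itv/=; lra.
  have [t1|t1] := leP t 1.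
    rewrite probability_integral_transform_itvNyo ?t0//.
    rewrite [X in lebesgue_measure X](_ : _ = `[0, t[%classic).
      by rewrite lebesgue_measure_itv/= lte_fin t0 sube0.
    by apply/seteqP; split=> x /=; rewrite !in_itv/=; lra.
  rewrite [X in P X](_ : _ = setT); last first.
    rewrite -subTset => x _ /=; rewrite in_itv/=.
    exact: le_lt_trans (fine_cdf_le1 _) t1.
  rewrite probability_setT [X in lebesgue_measure X](_ : _ = `[0, 1]%classic).
    by rewrite lebesgue_measure_itv/= lte_fin ltr01 sube0.
  by apply/seteqP; split=> x /=; rewrite !in_itv/=; lra.
pose V : {mfun T >-> measurableTypeR R} :=
  @mfun_Sub _ _ T (measurableTypeR R) U (mem_set measurable_U).
have m01 : measurable (`[0, 1]%classic : set (measurableTypeR R)).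
  exact: measurable_itv.
(* Open rays generate the Borel sets and are stable under intersection, and those with natural
   endpoints cover the line; two finite measures that agree on them are equal. *)
rewrite RGenInftyO.measurableE => mA.
change (distribution P V A = mrestr lebesgue_measure m01 A).
have := @g_sigma_algebra_measure_unique _ R (measurableTypeR R)
  (@RGenInftyO.G R) _ (fun n => `]-oo, n%:R[%classic) _ _
  (distribution P V) (mrestr lebesgue_measure m01).
apply; [| | | | | |exact: mA].
- by move=> _ [x ->]; exact: measurable_itv.
- by move=> n; exists n%:R.
- rewrite -subTset => x _; exists (Num.truncn x).+1 => //=.
  by rewrite in_itv/= truncnS_gt.
- move=> _ _ [x ->] [y ->]; exists (Num.min x y).
  apply/seteqP; split => z /=; rewrite !in_itv/= lt_min.
    by move=> [-> ->].
  by move=> /andP.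
- by move=> _ [t ->]; exact: rays.
- by move=> n; rewrite (le_lt_trans (probability_le1 _ _)) ?ltry.
Qed.

End continuous_cdf.

Theorem corollary3 (R : realType) (C : topologicalGroupType)
    (cantorC : cantor_set C)
    (mu : probability (borelType C) R) (haar_mu : haar_probability mu) :
  exists phi : C -> R,
    [/\ continuous phi,
        range phi `<=` `[0, 1] &
        forall A : set (measurableTypeR R), measurable A -> A `<=` `[0, 1] ->
          pushforward mu (phi : borelType C -> measurableTypeR R) A
          = lebesgue_measure A].
Proof.
have [_ [pC _ hC _] _] := cantorC.
have [h ch ih] := cantor_embedding (R := R) cantorC.
pose X : {RV mu >-> R} := mfun_Sub (mem_set (continuous_borel_measurable ch)).
(* Since [h] is injective, each fibre is empty or a single point, which is null for Haar measure. *)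
have X_atomless r : mu (X @^-1` [set r]) = 0%E.
  have [[x hx]|nhx] := pselect (exists x, h x = r).
    rewrite (_ : _ @^-1` _ = [set x]) ?(haar_atomless hC pC haar_mu)//.
    by apply/seteqP; split => y /=; [rewrite -hx => /ih|move=> ->].
  rewrite (_ : _ @^-1` _ = set0) ?measure0//.
  by rewrite -subset0 => y /= hy; apply: nhx; exists y.
exists (fun x => fine (cdf X (X x))); split.
- move=> x; apply: (@continuous_comp _ _ _ h (fine \o cdf X)); first exact: ch.
  exact: continuous_fine_cdf.
- by move=> _ [x _ <-]; rewrite /= in_itv/= fine_cdf_ge0 fine_cdf_le1.
- move=> A mA A01; rewrite -[in RHS](setIidl A01).
  exact: probability_integral_transform.
Qed.
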